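(* Let $\gamma \geq 0$ be an integer and let $\mathcal{M}$ be a $\gamma$-multiprojection algebra with operations $\star_a$ and endomorphisms $\pi_a$, $a \in [\gamma]$. Then the vector space $\mathcal{M}$ endowed with the binary linear operations $\dashv_a, \vdash_a$, $a \in [\gamma]$, defined for all $x, y \in \mathcal{M}$ by $$x \dashv_a y := x \star_a \pi_a(y) \qquad \text{and} \qquad x \vdash_a y := \pi_a(x) \star_a y$$ is a $\gamma$-pluriassociative algebra.
   Context: The ground field has characteristic zero; $[\gamma] = \{1, \dots, \gamma\}$; $a \uparrow a' := \max(a, a')$. A $\gamma$-multiassociative algebra is a vector space $\mathcal{M}$ with linear operations $\star_a : \mathcal{M} \otimes \mathcal{M} \to \mathcal{M}$, $a \in [\gamma]$, satisfying for all $x, y, z \in \mathcal{M}$ $(x \star_a y) \star_b z = (x \star_b y) \star_{a'} z = x \star_{a''} (y \star_b z) = x \star_b (y \star_{a'''} z)$ for all $a, a', a'', a''' \leq b \in [\gamma]$. A $\gamma$-multiprojection algebra is a $\gamma$-multiassociative algebra $\mathcal{M}$ endowed with endomorphisms $\pi_a : \mathcal{M} \to \mathcal{M}$, $a \in [\gamma]$, of $\gamma$-multiassociative algebras (linear maps commuting with all the operations $\star_b$), satisfying $\pi_a \circ \pi_{a'} = \pi_{a \uparrow a'}$ for all $a, a' \in [\gamma]$. A $\gamma$-pluriassociative algebra is a vector space with binary linear operations $\dashv_a, \vdash_a$, $a \in [\gamma]$, satisfying for all elements $x, y, z$ and all $a, a' \in [\gamma]$: $(x \vdash_{a'} y) \dashv_a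 z = x \vdash_{a'} (y \dashv_a z)$; $(x \dashv_{a \uparrow a'} y) \dashv_a z = x \dashv_a (y \vdash_{a'} z)$; $(x \dashv_{a'} y) \vdash_a z = x \vdash_a (y \vdash_{a \uparrow a'} z)$; $(x \dashv_a y) \dashv_{a \uparrow a'} z = x \dashv_a (y \dashv_{a'} z)$; $(x \vdash_{a'} y) \vdash_a z = x \vdash_{a \uparrow a'} (y \vdash_a z)$. *)

(* Defs.v *)
From HB Require Import structures.
From mathcomp Require Import all_boot all_order all_algebra.

Set Implicit Arguments.
Unset Strict Implicit.
Unset Printing Implicit Defensive.

Import Order.TTheory GRing.Theory.
Local Open Scope ring_scope.

(* The index set [gamma] = {1, ..., gamma} is rendered by the ordinals          *)
(* 'I_gamma = {0, ..., gamma - 1}: indices only enter through their order, so   *)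
(* a : 'I_gamma stands for a + 1 and a `up` a' is Order.max a a'.               *)

(* A linear operation M (x) M -> M is given as a bilinear function of two       *)
(* arguments.                                                                   *)
Definition bilinear_op (K : fieldType) (M : lmodType K) (op : M -> M -> M) :
    Prop :=
  bilinear_for *:%R *:%R op.

Record multiassociative (K : fieldType) (gamma : nat) (M : lmodType K)
    (star : 'I_gamma -> M -> M -> M) : Prop := Multiassociative {
  star_bilinear : forall a, bilinear_op (star a);
  star_assoc : forall (a a' a'' a''' b : 'I_gamma) (x y z : M),
    (a <= b)%O -> (a' <= b)%O -> (a'' <= b)%O -> (a''' <= b)%O ->
    [/\ star b (star a x y) z = star a' (star b x y) z,
        star a' (star b x y) z = star a'' x (star b y z)
      & star a'' x (star b y z) = star b x (star a''' y z)]
}.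

Record multiassociative_endomorphism (K : fieldType) (gamma : nat)
    (M : lmodType K) (star : 'I_gamma -> M -> M -> M) (f : M -> M) : Prop :=
    MultiassociativeEndomorphism {
  endo_linear : linear f;
  endo_star : forall (b : 'I_gamma) (x y : M),
    f (star b x y) = star b (f x) (f y)
}.

Record multiprojection (K : fieldType) (gamma : nat) (M : lmodType K)
    (star : 'I_gamma -> M -> M -> M) (pi : 'I_gamma -> M -> M) : Prop :=
    Multiprojection {
  multiproj_assoc : multiassociative star;
  multiproj_endo : forall a, multiassociative_endomorphism star (pi a);
  multiproj_comp : forall (a a' : 'I_gamma) (x : M),
    pi a (pi a' x) = pi (Order.max a a') x
}.

Record pluriassociative (K : fieldType) (gamma : nat) (M : lmodType K)
    (dashv vdash : 'I_gamma -> M -> M -> M) : Prop := Pluriassociative {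
  dashv_bilinear : forall a, bilinear_op (dashv a);
  vdash_bilinear : forall a, bilinear_op (vdash a);
  vdash_dashv : forall (a a' : 'I_gamma) (x y z : M),
    dashv a (vdash a' x y) z = vdash a' x (dashv a y z);
  dashv_vdash_r : forall (a a' : 'I_gamma) (x y z : M),
    dashv a (dashv (Order.max a a') x y) z = dashv a x (vdash a' y z);
  dashv_vdash_l : forall (a a' : 'I_gamma) (x y z : M),
    vdash a (dashv a' x y) z = vdash a x (vdash (Order.max a a') y z);
  dashv_dashv : forall (a a' : 'I_gamma) (x y z : M),
    dashv (Order.max a a') (dashv a x y) z = dashv a x (dashv a' y z);
  vdash_vdash : forall (a a' : 'I_gamma) (x y z : M),
    vdash a (vdash a' x y) z = vdash (Order.max a a') x (vdash a y z)
}.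

(* Main.v *)
Require Import Defs.
From HB Require Import structures.
From mathcomp Require Import all_boot all_order all_algebra.

(* All the products of x, y, z in this order with operations of indices a and b
   are equal, whatever the bracketing and the order of a and b: they depend only
   on max(a, b). Each pluriassociativity relation then reduces, after pushing
   pi_a inside a product, to the equality of the arguments and of the maxima of
   the indices on both sides. *)

Lemma star_maxl (K : fieldType) (gamma : nat) (M : lmodType K)
    (star : 'I_gamma -> M -> M -> M) (starA : multiassociative star)
    (a b : 'I_gamma) (x y z : M) :
  star b (star a x y) z =
  star (Order.max a b) (star (Order.max a b) x y) z.
Proof.
have [le_ab | lt_ba] := Order.TotalTheory.leP a b.
  by have [-> _ _] := star_assoc starA x y z le_ab (Order.le_refl b)
                        (Order.le_refl b) (Order.le_refl b).
have le_ba := Order.POrderTheory.ltW lt_ba.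
(* The dominating index is now the inner one, so the axiom is taken with [a] as its [b] and with [b]
   as its [a']. *)
have [<- _ _] := star_assoc starA x y z (Order.le_refl a) le_ba
                   (Order.le_refl a) (Order.le_refl a).
by [].
Qed.

(** Same normal form as in [star_maxl], so that rewriting with both makes the two bracketings
    comparable. *)
Lemma star_maxr (K : fieldType) (gamma : nat) (M : lmodType K)
    (star : 'I_gamma -> M -> M -> M) (starA : multiassociative star)
    (a b : 'I_gamma) (x y z : M) :
  star a x (star b y z) =
  star (Order.max a b) (star (Order.max a b) x y) z.
Proof.
have [le_ab | lt_ba] := Order.TotalTheory.leP a b.
  by have [_ -> _] := star_assoc starA x y z (Order.le_refl b)
                        (Order.le_refl b) le_ab (Order.le_refl b).
have le_ba := Order.POrderTheory.ltW lt_ba.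
by have [_ -> ->] := star_assoc starA x y z (Order.le_refl a)
                       (Order.le_refl a) (Order.le_refl a) le_ba.
Qed.

Theorem theorem3p3p2 (K : fieldType) (charK : [pchar K]%R =i pred0)
    (gamma : nat) (M : lmodType K)
    (star : 'I_gamma -> M -> M -> M) (pi : 'I_gamma -> M -> M)
    (hM : multiprojection star pi) :
  pluriassociative
    (fun a x y => star a x (pi a y))
    (fun a x y => star a (pi a x) y).
Proof.
have [starA endo pi_comp] := hM.
have pi_lin a := endo_linear (endo a).
have pi_star a := endo_star (endo a).
have maxl := star_maxl _ _ _ _ starA; have maxr := star_maxr _ _ _ _ starA.
have maxC (a a' : 'I_gamma) : Order.max a a' = Order.max a' a.
  exact: Order.TotalTheory.maxC.
(* Needed where an operation already carries the index [Order.max a a']. *)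
have max_absl (a a' : 'I_gamma) :
    Order.max a (Order.max a a') = Order.max a a'.
  by rewrite Order.TotalTheory.maxA Order.POrderTheory.maxxx.
split.
- move=> a; have [linl linr] := star_bilinear starA a.
  (* [pi_lin] applies only in the slot that goes through [pi a]. *)
  by split=> [z k x y | z k x y] /=; rewrite ?pi_lin; [exact: linl | exact: linr].
- move=> a; have [linl linr] := star_bilinear starA a.
  by split=> [z k x y | z k x y] /=; rewrite ?pi_lin; [exact: linl | exact: linr].
(* Both sides multiply [pi a' x], [y] and [pi a z]. *)
- by move=> a a' x y z; rewrite maxl maxr.
(* On the right, [pi a] meets [pi a' y] and yields the [pi (Order.max a a') y] of the left. *)
- by move=> a a' x y z; rewrite pi_star pi_comp maxl maxr (maxC _ a) max_absl.
- by move=> a a' x y z; rewrite pi_star pi_comp maxl maxr (maxC a') max_absl.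
- by move=> a a' x y z; rewrite pi_star pi_comp maxl maxr max_absl.
- by move=> a a' x y z; rewrite pi_star pi_comp maxl maxr (maxC a') (maxC _ a) max_absl.
Qed.
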